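(* Let $\{f_n\}$ be a sequence of summable functions defined a.e. on $\mathbb{R}$ and let $f_n\to f$ a.e. on $\mathbb{R}$. If there exists a summable nonnegative function $g$ such that $|f_n(x)|\le g(x)$ for a.e. $x\in\mathbb{R}$ (for every $n$), then $f$ is summable and $$\lim_{n\to+\infty}\int_{-\infty}^{+\infty}f_n(x)\,dx=\int_{-\infty}^{+\infty}f(x)\,dx ,$$ the integrals being Lebesgue integrals in the sense of Tonelli (defined in the context).
   Context: A multiinterval $\Delta=\{(a_n,b_n)\}$ is a finite or countable sequence of open intervals of $\mathbb{R}$ (not necessarily disjoint); $\mathcal{I}_\Delta=\bigcup_n(a_n,b_n)$ and $L(\Delta)=\sum_n(b_n-a_n)\in(0,+\infty]$. A set $N\subseteq\mathbb{R}$ is a null set if for every $\varepsilon>0$ there is a multiinterval $\Delta$ with $L(\Delta)<\varepsilon$ and $N\subseteq\mathcal{I}_\Delta$. A property holds a.e. if it fails only on a null set. A real function $f$ defined a.e. on an interval $R$ (possibly unbounded) is quasicontinuous on $R$ if for every $\varepsilon>0$ there is a multiinterval $\Delta_\varepsilon$ with $L(\Delta_\varepsilon)<\varepsilon$ such that $f$ is defined on $R\setminus\mathcal{I}_{\Delta_\varepsilon}$ and the restriction $f_{|R\setminus\mathcal{I}_{\Delta_\varepsilon}}$ is continuous. Lebesgue integral (Tonelli), bounded case: let $f$ be bounded quasicontinuous on the bounded closed interval $R=[h,k]$. Choose for each $n$ a multiinterval $\Delta_n$ with $L(\Delta_n)<1/n$ such that $f_{|R\setminus\mathcal{I}_{\Delta_n}}$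 is continuous, and let $\phi_n$ be a continuous extension of $f_{|R\setminus\mathcal{I}_{\Delta_n}}$ to $R$ having the same infimum and supremum as $f_{|R\setminus\mathcal{I}_{\Delta_n}}$. Then $\int_h^k f:=\lim_n\int_h^k\phi_n$ (Riemann integrals on the right; the limit exists and does not depend on the choices). General case: for $f$ quasicontinuous on $\mathbb{R}$ put $f_+=\max\{f,0\}$, $f_-=\min\{f,0\}$ and $\int_{\mathbb{R}}f_+:=\lim_{\rho\to+\infty,\,N\to+\infty}\int_{-\rho}^{\rho}\min\{f_+(x),N\}\,dx\in[0,+\infty]$, $\int_{\mathbb{R}}f_-:=\lim_{\rho\to+\infty,\,K\to+\infty}\int_{-\rho}^{\rho}\max\{f_-(x),-K\}\,dx\in[-\infty,0]$. The quasicontinuous function $f$ is integrable if at least one of these two is finite, and then $\int_{\mathbb{R}}f:=\int_{\mathbb{R}}f_++\int_{\mathbb{R}}f_-$; it is summable if this integral is finite. *)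

(* Defs.v *)
From Stdlib Require Import Reals.
From Coquelicot Require Import Coquelicot.
Open Scope R_scope.

(** A finite or countable family of nonempty bounded open intervals
    [(mi_lo n, mi_hi n)]; only the indices selected by [mi_idx] belong to the
    family, so a finite sequence is one with finitely many selected indices.
    Since at least one interval is present, the total length is positive. *)
Record multiinterval := MultiInterval {
  mi_idx : nat -> bool;
  mi_lo : nat -> R;
  mi_hi : nat -> R;
  mi_lt : forall n, mi_idx n = true -> mi_lo n < mi_hi n;
  mi_inhabited : exists n, mi_idx n = true
}.

Definition mi_union (D : multiinterval) (x : R) : Prop :=
  exists n, mi_idx D n = true /\ mi_lo D n < x < mi_hi D n.

(** The partial sums are nondecreasing, so [Lim_seq] is their actual limit,
    possibly [p_infty]. *)
Definition mi_length (D : multiinterval) : Rbar :=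
  Lim_seq (sum_n (fun n => if mi_idx D n then mi_hi D n - mi_lo D n else 0)).

Definition null_set (N : R -> Prop) : Prop :=
  forall eps : R, 0 < eps ->
    exists D : multiinterval,
      Rbar_lt (mi_length D) eps /\ (forall x, N x -> mi_union D x).

Definition ae_on (I P : R -> Prop) : Prop := null_set (fun x => I x /\ ~ P x).

Definition line : R -> Prop := fun _ => True.

Definition segment (h k : R) : R -> Prop := fun x => h <= x <= k.

(** A partially defined real function. The values of [pval] outside [pdom]
    carry no meaning, and no notion below depends on them. *)
Record pfun := PFun {
  pdom : R -> Prop;
  pval :> R -> R
}.

(** The part of [I] left uncovered by [D]. *)
Definition off (I : R -> Prop) (D : multiinterval) : R -> Prop :=
  fun x => I x /\ ~ mi_union D x.

(** [f] is defined on [I] minus the intervals of [D], and its restriction to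
    that set is continuous for the subspace topology. *)
Definition continuous_off (I : R -> Prop) (f : pfun) (D : multiinterval) : Prop :=
  (forall x, off I D x -> pdom f x) /\ continuous_on (off I D) (pval f).

Definition quasicontinuous (I : R -> Prop) (f : pfun) : Prop :=
  ae_on I (pdom f) /\
  forall eps : R, 0 < eps ->
    exists D : multiinterval,
      Rbar_lt (mi_length D) eps /\ continuous_off I f D.

Definition bounded_pfun (I : R -> Prop) (f : pfun) : Prop :=
  exists M : R, forall x, I x -> pdom f x -> Rabs (f x) <= M.

Definition image (A : R -> Prop) (u : R -> R) : R -> Prop :=
  fun y => exists x, A x /\ y = u x.

(** [phi] is a continuous function on [I] extending the restriction of [f] off
    [D], with the same infimum and supremum. As the bounds of the empty set
    are [p_infty] and [m_infty], this forces [off I D] to be nonempty when [I]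
    is. *)
Definition tonelli_extension (I : R -> Prop) (f : pfun) (D : multiinterval)
    (phi : R -> R) : Prop :=
  continuous_on I phi /\
  (forall x, off I D x -> phi x = f x) /\
  Glb_Rbar (image I phi) = Glb_Rbar (image (off I D) f) /\
  Lub_Rbar (image I phi) = Lub_Rbar (image (off I D) f).

(** The bound [1/n] for [n >= 1] is indexed from [0]. *)
Definition tonelli_approx (h k : R) (f : pfun) (phi : nat -> R -> R) : Prop :=
  exists D : nat -> multiinterval,
    forall n,
      Rbar_lt (mi_length (D n)) (/ INR (S n)) /\
      continuous_off (segment h k) f (D n) /\
      tonelli_extension (segment h k) f (D n) (phi n).

(** [l] is the integral of the bounded quasicontinuous function [f] on
    [[h, k]]: approximating sequences exist, and the Riemann integrals of any
    of them converge to [l]. *)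
Definition is_TInt (f : pfun) (h k l : R) : Prop :=
  h < k /\
  quasicontinuous (segment h k) f /\
  bounded_pfun (segment h k) f /\
  (exists phi, tonelli_approx h k f phi) /\
  (forall phi, tonelli_approx h k f phi ->
     is_lim_seq (fun n => RInt (phi n) h k) l).

Definition TInt (f : pfun) (h k : R) : R := iota (is_TInt f h k).

Definition pos_part (f : pfun) : pfun := PFun (pdom f) (fun x => Rmax (f x) 0).

(** With this sign convention the negative part is nonpositive. *)
Definition neg_part (f : pfun) : pfun := PFun (pdom f) (fun x => Rmin (f x) 0).

Definition cut_above (N : R) (f : pfun) : pfun :=
  PFun (pdom f) (fun x => Rmin (f x) N).

Definition cut_below (K : R) (f : pfun) : pfun :=
  PFun (pdom f) (fun x => Rmax (f x) (- K)).

(** Joint limit as both components of the pair tend to [+oo]. *)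
Definition is_double_lim (F : R -> R -> R) (l : Rbar) : Prop :=
  filterlim (fun p : R * R => F (fst p) (snd p))
    (filter_prod (Rbar_locally p_infty) (Rbar_locally p_infty))
    (Rbar_locally l).

Definition is_LInt_pos (f : pfun) (l : Rbar) : Prop :=
  is_double_lim
    (fun rho N => TInt (cut_above N (pos_part f)) (- rho) rho) l.

Definition is_LInt_neg (f : pfun) (l : Rbar) : Prop :=
  is_double_lim
    (fun rho K => TInt (cut_below K (neg_part f)) (- rho) rho) l.

(** [f] is integrable on the line, with integral [l]. One of the two parts
    being finite, [Rbar_plus] never meets an indeterminate form. *)
Definition is_LInt (f : pfun) (l : Rbar) : Prop :=
  quasicontinuous line f /\
  exists lp lm : Rbar,
    is_LInt_pos f lp /\ is_LInt_neg f lm /\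
    (is_finite lp \/ is_finite lm) /\
    l = Rbar_plus lp lm.

Definition summable (f : pfun) : Prop := exists l : R, is_LInt f l.

(** Meaningful for summable functions, the only ones to which it is applied. *)
Definition LInt (f : pfun) : R := iota (fun l : R => is_LInt f l).

Definition nonnegative (f : pfun) : Prop := forall x, pdom f x -> 0 <= f x.

Definition cvg_ae (fn : nat -> pfun) (f : pfun) : Prop :=
  ae_on line (fun x =>
    (forall n, pdom (fn n) x) /\ pdom f x /\
    is_lim_seq (fun n => fn n x) (f x)).

Definition dominated_ae (f g : pfun) : Prop :=
  ae_on line (fun x => pdom f x /\ pdom g x /\ Rabs (f x) <= g x).

(* Main.v *)
From Stdlib Require Import Reals.
From Coquelicot Require Import -(notations) Coquelicot.
From mathcomp Require Import all_boot all_order all_algebra.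
From mathcomp Require Import all_classical all_reals all_analysis.
From mathcomp Require Import measurable_realfun Rstruct Rstruct_topology.
Require Import Defs.

(** Tonelli's integral is the Lebesgue integral in disguise, and the theorem is
    the classical dominated convergence theorem read through that dictionary.

    The dictionary rests on one notion: a Borel function [F], defined
    everywhere, is a [borel_version] of the partial function [f] when [f] is
    defined and equal to [F] outside a null set.  Null sets are the sets of
    Lebesgue outer measure zero ([null_setE]), because the outer measure is an
    infimum over covers by open intervals ([mi_cover], [mu_mi_union]).

    Quasicontinuous means having a Borel version.  If [f] is continuous on
    closed sets [K n] whose complements have measure at most [1 / (n + 1)],
    then [f] is Borel on the union of the [K n], which misses only a null set
    ([quasicontinuous_borel_version]).  The converse is Lusin's theorem on
    [[-n, n]] with error [eps / 2 ^ (n + 2)], all the exceptional sets being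
    swallowed by one multiinterval ([borel_version_quasicontinuous]).

    On a segment, Tonelli's integral of a bounded function is the Lebesgue
    integral of a bounded Borel version ([TInt_integral]).  A continuous
    extension [phi n] inherits the bound [M], and differs from [F] only on the
    exceptional multiinterval and on a null set, so its Riemann integral, which
    is a Lebesgue integral by the fundamental theorem of calculus
    ([integral_RInt]), is within [2 M / (n + 1)] of the integral of [F]
    ([tonelli_approx_error]).  Such extensions exist by Tietze's theorem
    followed by a clamp to the range of [f] ([tonelli_extension_exists]).

    On the line, the double limit over the truncations at height [N] and
    width [rho] is the integral of the positive part, by monotone convergence
    ([truncate_double_lim]).  Hence [f] is summable exactly when a Borel
    version is Lebesgue integrable, with the same integral
    ([is_LInt_integral]).

    It remains to discard one Borel null set outside which every almost
    everywhere hypothesis holds everywhere.  Redefining all functions as zero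
    on it gives Borel versions that converge and are dominated at every point;
    their limit is Borel, hence a Borel version of [f], and the dominated
    convergence theorem of Lebesgue concludes. *)

Section Lebesgue.
Import Order.TTheory GRing.Theory Num.Theory.
Import numFieldNormedType.Exports.
Set Implicit Arguments.
Unset Strict Implicit.
Unset Printing Implicit Defensive.
Local Open Scope classical_set_scope.
Local Open Scope ring_scope.

(** * Lebesgue outer measure and multiintervals *)

(** Naming the structure keeps the inference of topology, order and Borel sets
    from unfolding to the bare type of reals. *)
Definition RT : realType := R.
Notation mu := (@lebesgue_measure RT).

(** [mu] is an outer measure defined on every set of reals, so these facts ask
    for no measurability; the exceptional sets below are seldom known to be
    Borel. *)
Lemma mu_ge0 (A : set RT) : (0 <= mu A)%E.
Proof. exact: (outer_measure_ge0 (wlength idfun)^*%mu). Qed.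

Lemma le_mu (A B : set RT) : A `<=` B -> (mu A <= mu B)%E.
Proof. exact: (le_outer_measure (wlength idfun)^*%mu). Qed.

Lemma mu_setU (A B : set RT) : (mu (A `|` B) <= mu A + mu B)%E.
Proof. exact: (outer_measureU2 (wlength idfun)^*%mu). Qed.

Lemma mu_bigcup (A : nat -> set RT) :
  (mu (\bigcup_n A n) <= \sum_(0 <= n <oo) mu (A n))%E.
Proof. exact: (outer_measure_sigma_subadditive (wlength idfun)^*%mu). Qed.

Lemma mu_eq0 (A : set RT) : (mu A <= 0)%E -> mu A = 0%E.
Proof. by move=> A0; apply/eqP; rewrite eq_le A0 mu_ge0. Qed.

Lemma mu0_sub (A B : set RT) : A `<=` B -> mu B = 0%E -> mu A = 0%E.
Proof. by move=> AB B0; apply: mu_eq0; rewrite -B0; exact: le_mu. Qed.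

Lemma mu0_setU (A B : set RT) : mu A = 0%E -> mu B = 0%E -> mu (A `|` B) = 0%E.
Proof.
by move=> A0 B0; apply: mu_eq0; rewrite (le_trans (mu_setU _ _))// A0 B0 add0e.
Qed.

Lemma mu0_bigcup (A : nat -> set RT) :
  (forall n, mu (A n) = 0%E) -> mu (\bigcup_n A n) = 0%E.
Proof.
move=> A0; apply: mu_eq0; apply: (le_trans (mu_bigcup A)).
by rewrite eseries0// => n _ _; exact: A0.
Qed.

Lemma sum_nE (a : nat -> R) n : sum_n a n = \sum_(i < n.+1) (a i : RT).
Proof.
elim: n => [|n IH]; first by rewrite sum_O big_ord1.
by rewrite sum_Sn IH [RHS]big_ord_recr.
Qed.

Definition mi_len (D : multiinterval) n : RT :=
  if mi_idx D n then mi_hi D n - mi_lo D n else 0.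

Lemma mi_len_ge0 D n : 0 <= mi_len D n.
Proof.
rewrite /mi_len; case: ifP => // Dn; rewrite subr_ge0.
by apply/RleP/Rlt_le/(mi_lt D n Dn).
Qed.

Lemma sum_mi_len_incr D n : (sum_n (mi_len D) n <= sum_n (mi_len D) n.+1)%coqR.
Proof.
by rewrite sum_Sn; apply/RleP; rewrite /Hierarchy.plus /= RplusE lerDl mi_len_ge0.
Qed.

Lemma mi_union_bigcup D : mi_union D =
  \bigcup_n (if mi_idx D n then `]mi_lo D n : RT, mi_hi D n : RT[%classic else set0).
Proof.
apply/seteqP; split=> x.
  move=> [n [Dn [/RltP lox /RltP xhi]]]; exists n => //.
  by rewrite Dn /= in_itv /= lox xhi.
move=> [n _]; case: ifP => // Dn; rewrite /= in_itv /= => /andP[lox xhi].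
by exists n; split => //; split; apply/RltP.
Qed.

Lemma open_mi_union D : open (mi_union D : set RT).
Proof.
rewrite mi_union_bigcup; apply: bigcup_open => n _.
by case: ifP => _; [exact: interval_open | exact: open0].
Qed.

(** Countable subadditivity bounds the measure of a union by the sum of the
    lengths, and the partial sums stay below their finite limit. *)
Lemma mu_mi_union D (eps : RT) :
  Rbar_lt (mi_length D) (Rbar.Finite eps) -> (mu (mi_union D) < eps%:E)%E.
Proof.
rewrite /mi_length => Deps.
have := Lim_seq_correct _ (ex_lim_seq_incr _ (sum_mi_len_incr D)).
change (Rbar_lt (Lim_seq (sum_n (mi_len D))) eps) in Deps.
case: (Lim_seq _) Deps => [l /RltP leps lim| //| _ lim]; last first.
  have : Rbar_le (Rbar.Finite 0) m_infty.
    apply: (is_lim_seq_le (fun=> 0) _ _ _ _ (is_lim_seq_const _) lim) => n.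
    by apply/RleP; rewrite sum_nE sumr_ge0// => i _; exact: mi_len_ge0.
  by [].
have suml n : \sum_(0 <= i < n) mi_len D i <= l.
  have lel : \sum_(i < n.+1) mi_len D i <= l.
    rewrite -sum_nE; apply/RleP.
    exact: is_lim_seq_incr_compare lim (sum_mi_len_incr D) n.
  by rewrite big_mkord (le_trans _ lel)// big_ord_recr /= lerDl mi_len_ge0.
apply: (@le_lt_trans _ _ (\sum_(0 <= i <oo) (mi_len D i)%:E)%E).
  rewrite mi_union_bigcup; apply: (le_trans (mu_bigcup _)).
  apply: lee_nneseries => [i _ _|i _]; first exact: mu_ge0.
  rewrite /mi_len; case: ifP => Di; last by rewrite measure0.
  rewrite lebesgue_measure_itv /= lte_fin.
  case: ifP => // _; rewrite lee_fin subr_ge0.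
  by apply/RleP/Rlt_le/(mi_lt D i Di).
apply: (@le_lt_trans _ _ l%:E); last by rewrite lte_fin.
apply: lime_le; first by apply: is_cvg_nneseries => n _ _; rewrite lee_fin mi_len_ge0.
by apply: nearW => n; rewrite sumEFin lee_fin.
Qed.

(** The outer measure is the infimum of the total lengths of the covers by
    open intervals; a cover of length less than [eps] leaves some slack, which
    pays for the one nonempty interval that a multiinterval must contain. *)
Lemma mi_cover (A : set RT) (eps : RT) : (mu A < eps%:E)%E ->
  exists D, Rbar_lt (mi_length D) (Rbar.Finite eps) /\ (forall x, A x -> mi_union D x).
Proof.
rewrite -[mu A]/((wlength idfun)^*%mu A) outer_measure_open_itv_cover.
move=> /ereal_inf_lt[_ /= [F [Fitv AF] <-]] Feps.
have /choice[ab abF] : forall k, exists ab : RT * RT, F k = `]ab.1, ab.2[%classic.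
  by move=> k; have [ab Fk] := Fitv k; exists ab.
pose len k : RT := Num.max 0 ((ab k).2 - (ab k).1).
have lenF k : wlength idfun (F k) = (len k)%:E.
  rewrite abF wlength_itv /= lte_fin /len; case: ifPn => ltab.
    by rewrite max_r// subr_ge0 ltW.
  by rewrite max_l// subr_le0 leNgt.
have len_ge0 k : 0 <= len k by rewrite /len le_max lexx.
rewrite (eq_eseriesr (fun k _ => lenF k)) in Feps.
have sum_ge0 : (0 <= \sum_(0 <= k <oo) (len k)%:E)%E.
  by apply: nneseries_ge0 => k _ _; rewrite lee_fin.
have sum_fin : (\sum_(0 <= k <oo) (len k)%:E)%E \is a fin_num.
  by rewrite ge0_fin_numE// (lt_trans Feps)// ltry.
move: Feps; set S := (\sum_(0 <= k <oo) _)%E in sum_ge0 sum_fin * => Feps.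
have {}Feps : fine S < eps by rewrite -lte_fin fineK.
pose d := (eps - fine S) / 2.
have d0 : 0 < d by rewrite divr_gt0// subr_gt0.
(* Interval 0 is the padding ]0, d[; interval k + 1 is the k-th of the cover,
   deselected when it is empty. *)
pose idx n := if n is k.+1 then (ab k).1 < (ab k).2 else true.
pose lo n := if n is k.+1 then (ab k).1 else 0.
pose hi n := if n is k.+1 then (ab k).2 else d.
have idxlt n : idx n = true -> Rlt (lo n) (hi n).
  by case: n => [_|k]; rewrite /idx /lo /hi => *; apply/RltP.
exists (@MultiInterval idx lo hi idxlt (ex_intro _ 0%N erefl)); split.
  rewrite /mi_length; apply: (@Rbar_le_lt_trans _ (Rbar.Finite (d + fine S))); last first.
    apply/RltP; rewrite /d -ltrBrDr ltr_pdivrMr// mulr_natr mulr2n.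
    by rewrite ltrDl subr_gt0.
  rewrite -(Lim_seq_const (d + fine S)); apply: Lim_seq_le_loc.
  exists 0%N => n _; apply/RleP; rewrite sum_nE big_ord_recl /=.
  rewrite RminusE subr0 lerD2l -lee_fin fineK//.
  apply: le_trans (nneseries_lim_ge n _) => [|i _ _]; last by rewrite lee_fin.
  rewrite sumEFin lee_fin big_mkord; apply: ler_sum => i _.
  rewrite /len /= add0n; case: ifPn => ltab; first by rewrite le_max RminusE lexx orbT.
  by rewrite le_max lexx.
move=> x /AF[k _]; rewrite abF /= in_itv /= => /andP[ax xb].
exists k.+1; split; first by rewrite /= (lt_trans ax xb).
by split; apply/RltP.
Qed.

Lemma null_setE (N : set RT) : null_set N <-> mu N = 0%E.
Proof.
split=> [N0|N0 eps /RltP eps0]; last first.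
  by apply: mi_cover; rewrite N0 lte_fin.
apply: mu_eq0; apply/lee_addgt0Pr => e e0; rewrite add0e.
have /RltP e0' := e0.
have [D [De ND]] := N0 e e0'.
apply: (@le_trans _ _ (mu (mi_union D))); last exact/ltW/mu_mi_union.
exact: le_mu.
Qed.

Lemma measurable_mi_union D : measurable (mi_union D : set RT).
Proof. by apply: open_measurable; exact: open_mi_union. Qed.

(** * Borel versions of quasicontinuous functions *)

(** The neighbourhood filters of the two topologies carried by the reals
    coincide; continuity statements pass from one to the other through this. *)
Lemma locally_nbhs (x : R) (P : R -> Prop) : Hierarchy.locally x P <-> nbhs (x : RT) P.
Proof.
have ballE (e : R) (y : R) : Hierarchy.ball x e y <-> ball (x : RT) e (y : RT).
  change (Rlt (Rabs (Rminus y x)) e <-> `|(x : RT) - y| < e).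
  by rewrite RabsE RminusE distrC; split => /RltP.
rewrite nbhs_ballP; split => [[e He]|[e /= e0 He]].
  exists (pos e); first by apply/RltP/cond_pos.
  by move=> y /ballE/He.
have /RltP e0' := e0.
by exists (mkposreal e e0') => y /ballE/He.
Qed.

Lemma continuous_on_within (D : set RT) (f : RT -> RT) :
  continuous_on D f <-> {within D, continuous f}.
Proof.
rewrite subspace_continuousP; split => cf x Dx P.
  by move/locally_nbhs/(cf x Dx)/locally_nbhs.
by move/locally_nbhs/(cf x Dx)/locally_nbhs.
Qed.

Definition borel_version (I : set RT) (f : pfun) (F : RT -> RT) : Prop :=
  measurable_fun setT F /\ mu [set x | I x /\ ~ (pdom f x /\ f x = F x)] = 0%E.

Lemma borel_version_sub (I J : set RT) f F : J `<=` I ->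
  borel_version I f F -> borel_version J f F.
Proof.
by move=> JI [mF F0]; split => //; apply: mu0_sub F0 => x /= [/JI].
Qed.

(** [f] is relatively continuous on each closed set [K n] left uncovered by
    the [n]-th multiinterval, so it is Borel on their countable union, and the
    complement of the union has measure at most [1 / (n + 1)] for all [n]. *)
Lemma quasicontinuous_borel_version (f : pfun) :
  quasicontinuous line f -> exists F, borel_version setT f F.
Proof.
move=> [_ qf].
have /choice[D Df] : forall n, exists D : multiinterval,
    Rbar_lt (mi_length D) (Rbar.Finite (n.+1%:R^-1 : RT)) /\ continuous_off line f D.
  by move=> n; apply: qf; apply/RltP; rewrite invr_gt0.
pose K n : set RT := ~` mi_union (D n).
have mK n : measurable (K n).
  by apply: measurableC; exact: measurable_mi_union.
have mUK : measurable (\bigcup_n K n) by apply: bigcup_measurable => n _.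
exists (pval f \_ (\bigcup_n K n)); split.
  apply: (measurable_restrictT _ mUK).1.
  apply: (measurable_fun_bigcup _ mK).2 => n.
  apply: subspace_continuous_measurable_fun => //.
  have [_ [_ cf]] := Df n; apply/continuous_on_within.
  by have -> : K n = off line (D n) by apply/seteqP; split => x //= [].
have small n : (mu [set x | setT x /\
    ~ (pdom f x /\ f x = (pval f \_ (\bigcup_n K n)) x)] <= n.+1%:R^-1%:E)%E.
  have [/mu_mi_union/ltW mun [fD _]] := Df n.
  apply: le_trans mun; apply: le_mu => x /= [_ nfx].
  apply: contrapT => xD; apply: nfx; split; first exact: fD.
  by rewrite patchT// inE; exists n.
apply: mu_eq0; apply/lee_addgt0Pr => e e0; rewrite add0e.
have [n] := near_infty_natSinv_lt (PosNum e0).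
move=> _ /(_ n (leqnn n)) /= /ltW ne.
by apply: (le_trans (small n)); rewrite lee_fin.
Qed.

(** Lusin's theorem applies to sets of finite measure only; using it on every
    [[-n, n]] with summable errors is enough, because continuity at [x] is a
    local matter and a neighbourhood of [x] lies in one of these segments. *)
Lemma borel_version_quasicontinuous (I : set RT) f F :
  borel_version I f F -> quasicontinuous I f.
Proof.
move=> [mF F0]; set N := [set x | _] in F0; split.
  by apply/null_setE; apply: mu0_sub F0 => x [Ix nfx]; split => // -[].
move=> eps /RltP eps0.
pose A n : set RT := `[- n%:R, n%:R]%classic.
pose e n : RT := eps / 2 / (2 ^ n.+1)%:R.
have e0 n : 0 < e n by rewrite !divr_gt0.
have mA n : measurable (A n) by exact: measurable_itv.
have muA n : (mu (A n) < +oo)%E.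
  by apply: compact_finite_measure; exact: segment_compact.
have /choice[K KP] : forall n, exists K : set RT, [/\ compact K, K `<=` A n,
    (mu (A n `\` K) < (e n)%:E)%E & {within K, continuous F}].
  move=> n; apply: measurable_almost_continuous => //.
    exact: muA.
  exact: measurable_funTS.
pose B := N `|` \bigcup_n (A n `\` K n).
have muB : (mu B < eps%:E)%E.
  apply: (@le_lt_trans _ _ (eps / 2)%:E); last first.
    by rewrite lte_fin ltr_pdivrMr// mulr_natr mulr2n ltrDl.
  apply: (le_trans (mu_setU _ _)).
  rewrite F0 add0e.
  apply: (le_trans (mu_bigcup _)).
  apply: le_trans (@epsilon_trick0 RT (eps / 2) xpredT _); last first.
    by rewrite divr_ge0// ltW.
  apply: lee_nneseries => n *; first exact: mu_ge0.
  by have [_ _ /ltW] := KP n.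
have [D [Deps BD]] := mi_cover muB.
exists D; split => //.
have offF x : off I D x -> pdom f x /\ f x = F x.
  move=> [Ix nDx]; apply: contrapT => nfx; apply: nDx; apply: BD.
  by left.
split; first by move=> x /offF[].
move=> x offx P /locally_nbhs Px; apply/locally_nbhs.
have [n xn] : exists n : nat, `|x| < n%:R.
  by exists (Num.truncn `|x|).+1; rewrite truncnS_gt.
have offK y : off I D y -> `|y| < n%:R -> K n y.
  move=> [_ nDy] yn; apply: contrapT => nKy; apply/nDy/BD.
  right; exists n => //; split => //.
  by rewrite /A /= in_itv /= -ler_norml ltW.
have [_ _ _ /subspace_continuousP cF] := KP n.
(* Near x the uncovered points all lie in K n, where F is continuous. *)
move: Px; rewrite (offF x offx).2 => Px.
have := cF x (offK x offx xn) P Px.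
rewrite /= !nbhs_simpl /= /within /=.
have : \forall y \near x, `|y| < n%:R.
  have [d /= d0 dn] : exists2 d : RT, 0 < d & `|x| + d <= n%:R.
    by exists (n%:R - `|x|); rewrite ?subr_gt0// addrC subrK.
  apply/nbhs_ballP; exists d => // y; rewrite /ball /= => xyd.
  rewrite (lt_le_trans _ dn)// -ltrBlDl (le_lt_trans _ xyd)//.
  by rewrite distrC lerB_dist.
apply: filterS2 => y yn KP' offy; rewrite (offF y offy).2.
exact/KP'/offK.
Qed.

(** * Riemann integrals of continuous functions *)

Lemma derivable_pt_lim_is_derive (F : RT -> RT) (x l : RT) :
  derivable_pt_lim F x l -> is_derive x (1 : RT) F l.
Proof.
move=> dF.
have cF : (fun h : RT => h^-1 *: (F (h *: 1 + x) - F x)) @ 0^' --> l.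
  apply/cvgrPdist_lt => e /RltP e0.
  have [[d /RltP /= d0] Fd] := dF e e0.
  near=> h.
  have h0 : h != 0 by near: h; exact: nbhs_dnbhs_neq.
  have hd : `|h| < d.
    near: h; exact: (@dnbhs0_lt RT RT).
  move/eqP in h0; move/RltP in hd; have /RltP := Fd h h0 hd.
  rewrite RabsE RminusE RdivE RminusE RplusE.
  by rewrite distrC [h *: 1]mulr1 (addrC h) /GRing.scale /= mulrC.
by apply: DeriveDef; [exact: cvgP cF | exact: cvg_lim cF].
Unshelve. all: by end_near. Qed.

Lemma segmentE (h k : R) : segment h k = `[h : RT, k : RT]%classic.
Proof.
apply/seteqP; split => x /=; rewrite in_itv /=.
  by move=> [/RleP -> /RleP ->].
by move=> /andP[/RleP ? /RleP].
Qed.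

(** For [h <= k], the point of the segment [[h, k]] nearest to [x]. *)
Definition clamp (h k x : R) : R := Rmax h (Rmin x k).

Lemma clamp_segment (h k x : R) : (h <= k)%coqR -> segment h k (clamp h k x).
Proof.
move=> hk; rewrite /clamp; split; first exact: Rmax_l.
by apply: Rmax_lub => //; exact: Rmin_r.
Qed.

Lemma clamp_id (h k x : R) : segment h k x -> clamp h k x = x.
Proof. by case=> hx xk; rewrite /clamp Rmin_left// Rmax_right. Qed.

Lemma clamp_lipschitz (h k x y : R) :
  (Rabs (clamp h k y - clamp h k x) <= Rabs (y - x))%coqR.
Proof.
rewrite /clamp /Rmin.
case: (Rle_dec y k) => ?; case: (Rle_dec x k) => ?; rewrite /Rmax;
  by repeat (case: Rle_dec => ?); split_Rabs; Lra.lra.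
Qed.

(** Precomposing with [clamp] extends a function continuous on a segment to the
    whole line, where derivatives of its primitive are two-sided. *)
Lemma continuous_clamp (h k : R) (phi : R -> R) x : (h <= k)%coqR ->
  continuous_on (segment h k) phi ->
  Continuity.continuous (fun y => phi (clamp h k y)) x.
Proof.
move=> hk cphi P Px.
have [e He] := cphi _ (clamp_segment x hk) P Px.
exists e => y xy; apply: He; last exact: clamp_segment.
change (Rlt (Rabs (Rminus (clamp h k y) (clamp h k x))) e).
change (Rlt (Rabs (Rminus y x)) e) in xy.
by apply: Rle_lt_trans xy; exact: clamp_lipschitz.
Qed.

(** Both integrals are the increment of one primitive, the Riemann integral of
    the extended function with variable upper bound. *)
Lemma integral_RInt (h k : R) (phi : R -> R) : (h < k)%coqR ->
  continuous_on (segment h k) phi ->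
  (\int[mu]_(x in `[h : RT, k : RT]) (phi x)%:E = (RInt phi h k)%:E)%E.
Proof.
move=> hk cphi; have hk' := Rlt_le _ _ hk.
pose g y := phi (clamp h k y).
have cg x : Continuity.continuous g x by exact: continuous_clamp.
pose G x := RInt g h x.
have dG x : is_derive (x : RT) (1 : RT) (G : RT -> RT) (g x).
  apply: derivable_pt_lim_is_derive; apply/is_derive_Reals.
  apply: (is_derive_RInt g G h x) => //.
  apply: Hierarchy.filter_forall => y; apply: (RInt_correct g).
  by apply: ex_RInt_continuous => z _; exact: cg.
have cG : continuous (G : RT -> RT).
  move=> x; apply: differentiable_continuous; apply/derivable1_diffP.
  by have [] := dG x.
rewrite (@continuous_FTC2 RT phi G); first last.
- move=> x; rewrite in_itv /= => /andP[/RltP hx /RltP xk].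
  rewrite derive1E; have [_ ->] := dG x; rewrite /g clamp_id//.
  by split; exact: Rlt_le.
- split; first by move=> x _; have [] := dG x.
  + by apply: cvg_at_right_filter; exact: cG.
  + by apply: cvg_at_left_filter; exact: cG.
- by rewrite -segmentE; exact/continuous_on_within.
- exact/RltP.
rewrite -EFinB; congr EFin.
rewrite /G RInt_point [X in _ - X](_ : _ = 0)// subr0.
apply: RInt_ext => x [+ +]; rewrite Rmin_left// Rmax_right// => hx xk.
by rewrite /g clamp_id//; split; exact: Rlt_le.
Qed.

(** * The Tonelli integral on a segment *)

Lemma bounded_Glb_Lub (S : R -> Prop) (M y0 : R) : S y0 ->
  (forall y, S y -> (Rabs y <= M)%coqR) ->
  exists m s : R, [/\ Glb_Rbar S = Rbar.Finite m, Lub_Rbar S = Rbar.Finite s &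
                     forall y, S y -> (m <= y <= s)%coqR].
Proof.
move=> Sy0 SM; have := Lub_Rbar_correct S; have := Glb_Rbar_correct S.
case: (Glb_Rbar S) => [m| |] [lbS glbS]; last 2 first.
- by have := lbS y0 Sy0.
- suff : Rbar_le (Rbar.Finite (- M)%coqR) m_infty by [].
  apply: glbS => y /SM; rewrite /= /Rabs.
  by case: Rcase_abs => *; Lra.lra.
case: (Lub_Rbar S) => [s| |] [ubS lubS]; last 2 first.
- suff : Rbar_le p_infty (Rbar.Finite M) by [].
  by apply: lubS => y /SM; apply: Rle_trans; exact: Rle_abs.
- by have := ubS y0 Sy0.
by exists m, s; split => // y Sy; split; [exact: lbS | exact: ubS].
Qed.

(** Tietze's theorem extends the restriction of [f] from the closed set
    [off (segment h k) D]; clamping the extension between the infimum and the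
    supremum of the restriction leaves it unchanged on that set and gives it
    the same bounds. *)
Lemma tonelli_extension_exists (f : pfun) (D : multiinterval) (h k M : R) :
  (exists x, off (segment h k) D x) -> continuous_off (segment h k) f D ->
  (forall x, off (segment h k) D x -> (Rabs (f x) <= M)%coqR) ->
  exists phi, tonelli_extension (segment h k) f D phi.
Proof.
move=> [x0 offx0] [_ cf] fM.
have [m [s [Gm Ls fms]]] : exists m s : R,
    [/\ Glb_Rbar (image (off (segment h k) D) f) = Rbar.Finite m,
        Lub_Rbar (image (off (segment h k) D) f) = Rbar.Finite s &
        forall y, image (off (segment h k) D) f y -> (m <= y <= s)%coqR].
  apply: (@bounded_Glb_Lub _ M (f x0)); first by exists x0.
  by move=> _ [x [offx ->]]; exact: fM.
have ms : (m <= s)%coqR.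
  by have [|? ?] := fms (f x0); [exists x0 | exact: Rle_trans (f x0) _ _ _].
have cloff : closed (off (segment h k) D : set RT).
  rewrite (_ : off _ _ = `[h : RT, k : RT]%classic `&` ~` mi_union D); last first.
    by rewrite -segmentE.
  apply: closedI; first exact: interval_closed.
  exact/open_closedC/open_mi_union.
have M0 : 0 < Num.max (M : RT) 1 by rewrite lt_max ltr01 orbT.
have [||g [gf cg _]] := continuous_bounded_extension
    (@pseudometric_normal RT RT) cloff (f := pval f) M0.
- exact/continuous_on_within.
- by move=> x /fM/RleP; rewrite RabsE le_max => ->.
pose phi x := clamp m s (g x).
have phif x : off (segment h k) D x -> phi x = f x.
  move=> offx; rewrite /phi -gf ?inE// clamp_id//.
  by apply: fms; exists x.
have phims x : (m <= phi x <= s)%coqR by exact: clamp_segment.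
have fphi y : image (off (segment h k) D) f y -> image (segment h k) phi y.
  by move=> [x [offx ->]]; exists x; split; [case: offx | rewrite phif].
exists phi; split; last split=> //.
  apply/continuous_on_within/continuous_subspaceT => x P.
  have cid : continuous_on (segment m s) id.
    by move=> y _ Q [e He]; exists e => z /He.
  have := @continuous_clamp m s id (g x) ms cid P.
  by move=> cc /locally_nbhs/cc/locally_nbhs; exact: cg.
have glbP := Glb_Rbar_correct (image (off (segment h k) D) f).
have lubP := Lub_Rbar_correct (image (off (segment h k) D) f).
rewrite Gm in glbP *; rewrite Ls in lubP *; split.
  apply: is_glb_Rbar_unique; split.
    by move=> _ [x [_ ->]]; case: (phims x).
  by move=> b lb; apply: glbP.2 => y /fphi; exact: lb.
apply: is_lub_Rbar_unique; split.
  by move=> _ [x [_ ->]]; case: (phims x).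
by move=> b ub; apply: lubP.2 => y /fphi; exact: ub.
Qed.

(** Intervals of total length less than [k - h] cannot cover [[h, k]]: this is
    what makes the infimum and supremum in [tonelli_extension] finite. *)
Lemma off_segment_nonempty (D : multiinterval) (h k : R) : (h < k)%coqR ->
  Rbar_lt (mi_length D) (Rbar.Finite (k - h)%coqR) ->
  exists x, off (segment h k) D x.
Proof.
move=> /RltP hk /mu_mi_union muD; apply: contrapT => noff.
have : (mu `[h : RT, k : RT] <= mu (mi_union D))%E.
  apply: le_mu => x; rewrite -segmentE => hxk.
  by apply: contrapT => nDx; apply: noff; exists x.
by rewrite lebesgue_measure_itv /= lte_fin hk -EFinB leNgt muD.
Qed.

Lemma tonelli_approx_exists (f : pfun) (h k M : R) : (h < k)%coqR ->
  quasicontinuous (segment h k) f ->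
  (forall x, segment h k x -> pdom f x -> (Rabs (f x) <= M)%coqR) ->
  exists phi, tonelli_approx h k f phi.
Proof.
move=> hk [_ qf] fM.
have /choice[Dp DpP] : forall n, exists Dp : multiinterval * (R -> R),
    [/\ Rbar_lt (mi_length Dp.1) (Rbar.Finite (/ INR n.+1)%coqR),
        continuous_off (segment h k) f Dp.1 &
        tonelli_extension (segment h k) f Dp.1 Dp.2].
  (* Lengths below k - h as well, so that something is left to extend. *)
  move=> n; have n0 : (0 < / INR n.+1)%coqR.
    by apply: Rinv_0_lt_compat; exact: lt_0_INR (PeanoNat.Nat.lt_0_succ n).
  have hk0 : (0 < k - h)%coqR by Lra.lra.
  have [D [Dlen cf]] := qf _ (Rmin_pos _ _ n0 hk0).
  have [||phi fphi] := @tonelli_extension_exists f D h k M _ cf.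
  - apply: off_segment_nonempty => //; apply: Rbar_lt_le_trans Dlen _.
    exact: Rmin_r.
  - by move=> x offx; apply: fM; [case: offx | exact: cf.1].
  exists (D, phi); split => //; apply: Rbar_lt_le_trans Dlen _.
  exact: Rmin_l.
exists (fun n => (Dp n).2), (fun n => (Dp n).1) => n.
by have [] := DpP n.
Qed.

(** A bound on the restriction passes to the extension because their infima
    and suprema agree. *)
Lemma tonelli_extension_bound (f : pfun) (D : multiinterval) (h k M : R) phi :
  tonelli_extension (segment h k) f D phi ->
  (forall x, off (segment h k) D x -> (Rabs (f x) <= M)%coqR) ->
  forall x, segment h k x -> (Rabs (phi x) <= M)%coqR.
Proof.
move=> [_ [_ [Gphi Lphi]]] fM x hxk.
have imx : image (segment h k) phi (phi x) by exists x.
have := Lub_Rbar_correct (image (segment h k) phi).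
have := Glb_Rbar_correct (image (segment h k) phi).
rewrite Gphi Lphi => -[/(_ _ imx) glb_phi _] [/(_ _ imx) phi_lub _].
have [_ glbP] := Glb_Rbar_correct (image (off (segment h k) D) f).
have [_ lubP] := Lub_Rbar_correct (image (off (segment h k) D) f).
apply: Rabs_le; split.
  apply: (Rbar_le_trans (Rbar.Finite _) _ (Rbar.Finite _)) glb_phi.
  apply: glbP => _ [y [/fM + ->]] /=.
  by rewrite /Rabs; case: Rcase_abs => *; Lra.lra.
apply: (Rbar_le_trans (Rbar.Finite _) _ (Rbar.Finite _)) phi_lub _.
apply: lubP => _ [y [/fM + ->]] /=.
by apply: Rle_trans; exact: Rle_abs.
Qed.

Lemma bounded_integrable_segment (F : RT -> RT) (h k M : RT) :
  measurable_fun `[h, k] F -> (forall x, `[h, k]%classic x -> `|F x| <= M) ->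
  mu.-integrable `[h, k] (EFin \o F).
Proof.
move=> mF FM; apply: measurable_bounded_integrable => //.
  by apply: compact_finite_measure; exact: segment_compact.
exists M; split; first exact: num_real.
by move=> M' MM' x hxk; apply: (le_trans (FM x hxk)); exact: ltW.
Qed.

(** On the segment, [phi] and [F] agree almost everywhere off [D] and are both
    bounded by [M], so [|phi - F|] is at most [2 M] times the indicator of the
    intervals of [D]. *)
Lemma tonelli_approx_error (f : pfun) (F : RT -> RT) (D : multiinterval)
    (h k M : R) (e : RT) phi : (h < k)%coqR ->
  borel_version (segment h k) f F ->
  (forall x, segment h k x -> pdom f x -> (Rabs (f x) <= M)%coqR) ->
  (forall x, `|F x| <= M) ->
  Rbar_lt (mi_length D) (Rbar.Finite e) ->
  continuous_off (segment h k) f D ->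
  tonelli_extension (segment h k) f D phi ->
  `|RInt phi h k - \int[mu]_(x in `[h : RT, k : RT]) F x| <= 2 * M * e.
Proof.
move=> hk [mF F0] fM FM muD cf ephi.
have M0 : 0 <= M by exact: le_trans (FM 0).
have phiM x : `[h : RT, k : RT]%classic x -> `|phi x| <= M.
  rewrite -segmentE -RabsE => hxk; apply/RleP.
  apply: (tonelli_extension_bound ephi) hxk => y offy.
  by apply: fM; [case: offy | exact: cf.1].
have mphi : measurable_fun `[h : RT, k : RT] (phi : RT -> RT).
  apply: subspace_continuous_measurable_fun => //.
  by rewrite -segmentE; apply/continuous_on_within; case: ephi.
have mF' : measurable_fun `[h : RT, k : RT] F by exact: measurable_funTS.
have mB : measurable_fun `[h : RT, k : RT] (fun x => (phi x)%:E - (F x)%:E)%E.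
  by apply: emeasurable_funB; exact/measurable_EFinP.
have iphi := bounded_integrable_segment mphi phiM.
have iF := bounded_integrable_segment mF' (fun x _ => FM x).
rewrite -lee_fin -abse_EFin EFinB -(integral_RInt hk); last by case: ephi.
rewrite /Rintegral fineK; last exact: integrable_fin_num.
rewrite -integralB_EFin//.
apply: (le_trans (le_abse_integral _ _ _)) => //.
apply: (@le_trans _ _ (\int[mu]_(x in `[h : RT, k : RT])
    (2 * M * \1_(mi_union D) x)%:E)%E).
  apply: ae_ge0_le_integral => //.
  - exact: measurableT_comp.
  - by move=> x _; rewrite lee_fin mulr_ge0// mulr_ge0.
  - apply/measurable_EFinP; apply: measurable_funM => //.
    apply: measurable_indic; exact: measurable_mi_union.
  apply/(negligible_outer_measure _).2; apply: mu0_sub F0 => x /= /not_implyP[].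
  move=> hxk lephi; have hxk' : segment h k x by rewrite segmentE.
  split => // -[fx fF]; apply: lephi.
  rewrite lee_fin indicE.
  case: (boolP (x \in _)) => [_|].
    rewrite mulr1 (le_trans (ler_normB _ _))// mulr_natl mulr2n lerD//.
    exact: phiM.
  rewrite notin_setE => nDx; rewrite mulr0 -fF.
  by have [_ [phif _]] := ephi; rewrite (phif x (conj hxk' nDx)) subrr normr0.
under eq_integral do rewrite EFinM.
rewrite ge0_integralZl//; last 2 first.
- by apply/measurable_EFinP/measurable_indic; exact: measurable_mi_union.
- by rewrite lee_fin mulr_ge0.
rewrite integral_indic//; last exact: measurable_mi_union.
rewrite [leRHS]EFinM lee_wpmul2l ?lee_fin ?mulr_ge0//.
apply: le_trans (ltW (mu_mi_union muD)).
by apply: le_mu; exact: subIsetl.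
Qed.

Lemma is_TInt_integral (f : pfun) (F : RT -> RT) (h k M : R) : (h < k)%coqR ->
  borel_version (segment h k) f F ->
  (forall x, segment h k x -> pdom f x -> (Rabs (f x) <= M)%coqR) ->
  (forall x, `|F x| <= M) ->
  is_TInt f h k (\int[mu]_(x in `[h : RT, k : RT]) F x).
Proof.
move=> hk fF fM FM.
have qf := borel_version_quasicontinuous fF.
split => //; split => //; split; first by exists M.
split; first exact: tonelli_approx_exists fM.
move=> phi [D phiD]; apply/is_lim_seq_Reals => e /RltP e0.
have M0 : 0 <= M by exact: le_trans (FM 0).
pose N := (Num.truncn (2 * M / e)).+1.
exists N => n /ssrnat.leP Nn; apply/RltP; rewrite RdistE.
have [Dn [cf ephi]] := phiD n.
apply: le_lt_trans (tonelli_approx_error hk fF fM FM Dn cf ephi) _.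
rewrite RinvE INRE ltr_pdivrMr// -ltr_pdivrMl// mulrC.
apply: (lt_le_trans (truncnS_gt _)).
by rewrite ler_nat -/N (leq_trans Nn).
Qed.

(** [TInt] is a definite description, and the limit along one approximating
    sequence already determines it. *)
Lemma TInt_integral (f : pfun) (F : RT -> RT) (h k M : R) : (h < k)%coqR ->
  borel_version (segment h k) f F ->
  (forall x, segment h k x -> pdom f x -> (Rabs (f x) <= M)%coqR) ->
  (forall x, `|F x| <= M) ->
  TInt f h k = \int[mu]_(x in `[h : RT, k : RT]) F x.
Proof.
move=> hk fF fM FM; have fT := is_TInt_integral hk fF fM FM.
apply: iota_unique => // y [_ [_ [_ [[phi ephi] limy]]]].
have [_ [_ [_ [_ limF]]]] := fT.
have := is_lim_seq_unique _ _ (limy phi ephi).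
by rewrite (is_lim_seq_unique _ _ (limF phi ephi)) => -[].
Qed.

(** * The integral of a positive part as a double limit *)

Definition Rbar_of_ereal (x : \bar RT) : Rbar :=
  match x with
  | r%:E => Rbar.Finite r
  | +oo%E => p_infty
  | -oo%E => m_infty
  end.

Definition truncate (F : RT -> RT) (N x : RT) : RT := Num.min (Num.max (F x) 0) N.

Lemma measurable_truncate (F : RT -> RT) N :
  measurable_fun setT F -> measurable_fun setT (truncate F N).
Proof.
move=> mF; apply: measurable_minr => //.
exact: measurable_maxr.
Qed.

Lemma truncate_ge0 F N x : 0 <= N -> 0 <= truncate F N x.
Proof. by move=> N0; rewrite le_min N0 le_max lexx orbT. Qed.

Lemma truncate_norm F N x : 0 <= N -> `|truncate F N x| <= N.
Proof. by move=> N0; rewrite ger0_norm ?truncate_ge0// ge_min lexx orbT. Qed.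

Lemma EFin_integral_truncate (F : RT -> RT) (N rho : RT) :
  measurable_fun setT F -> 0 <= N ->
  ((\int[mu]_(x in `[(- rho)%R, rho]) truncate F N x)%R%:E =
   \int[mu]_(x in `[(- rho)%R, rho]) (truncate F N x)%:E)%E.
Proof.
move=> mF N0; rewrite /Rintegral fineK//; apply: integrable_fin_num => //.
apply: (@bounded_integrable_segment _ _ _ N).
  by apply: measurable_funTS; exact: measurable_truncate.
by move=> x _; exact: truncate_norm.
Qed.

Lemma integral_truncate_le (F : RT -> RT) (N rho : RT) : measurable_fun setT F -> 0 <= N ->
  (\int[mu]_(x in `[(- rho)%R, rho]) (truncate F N x)%:E <=
   \int[mu]_x (Num.max (F x) 0)%:E)%E.
Proof.
move=> mF N0.
have mF0 : measurable_fun setT (fun x => (Num.max (F x) 0)%:E).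
  by apply/measurable_EFinP; exact: measurable_maxr.
apply: (@le_trans _ _ (\int[mu]_(x in `[(- rho)%R, rho]) (Num.max (F x) 0)%:E)%E).
  apply: ge0_le_integral => //.
  - by move=> x _; rewrite lee_fin truncate_ge0.
  - apply/measurable_EFinP; apply: measurable_funTS; exact: measurable_truncate.
  - exact: measurable_funTS.
  - by move=> x _; rewrite lee_fin ge_min lexx.
apply: ge0_subset_integral => // x _.
by rewrite lee_fin le_max lexx orbT.
Qed.

Lemma integral_truncate_mono (F : RT -> RT) (N N' rho rho' : RT) : measurable_fun setT F ->
  0 <= N -> N <= N' -> rho <= rho' ->
  (\int[mu]_(x in `[(- rho)%R, rho]) (truncate F N x)%:E <=
   \int[mu]_(x in `[(- rho')%R, rho']) (truncate F N' x)%:E)%E.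
Proof.
move=> mF N0 NN' rr'.
have mT M A : measurable A -> measurable_fun A (fun x => (truncate F M x)%:E).
  move=> mA; apply/measurable_EFinP; apply: measurable_funTS.
  exact: measurable_truncate.
apply: (@le_trans _ _ (\int[mu]_(x in `[(- rho)%R, rho]) (truncate F N' x)%:E)%E).
  apply: ge0_le_integral => //; try exact: mT.
  - by move=> x _; rewrite lee_fin truncate_ge0.
  - by move=> x _; rewrite lee_fin /truncate le_min !ge_min lexx/= NN' orbT.
apply: ge0_subset_integral => //; first exact: mT.
  by move=> x _; rewrite lee_fin truncate_ge0// (le_trans N0).
by apply: subset_itv; rewrite bnd_simp ?lerN2.
Qed.

(** Monotone convergence along the diagonal, where height and width are both
    [n]: at each point the truncations become stationary at the positive
    part. *)
Lemma integral_truncate_approx (F : RT -> RT) (r : RT) : measurable_fun setT F ->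
  (r%:E < \int[mu]_x (Num.max (F x) 0)%:E)%E ->
  exists n : nat,
    (r%:E < \int[mu]_(x in `[(- n%:R)%R, n%:R]) (truncate F n%:R x)%:E)%E.
Proof.
move=> mF rL; apply: contrapT => /forallNP small; move: rL; apply/negP.
rewrite -leNgt.
pose g n : RT -> \bar RT :=
  (fun x => (truncate F n%:R x)%:E) \_ `[(- n%:R)%R, n%:R]%classic.
have mg n : measurable_fun setT (g n).
  apply/(measurable_restrictT _ _).1 => //.
  by apply/measurable_EFinP; apply: measurable_funTS; exact: measurable_truncate.
have g0 n x : setT x -> (0 <= g n x)%E.
  by move=> _; rewrite /g patchE; case: ifP => //; rewrite lee_fin truncate_ge0.
have gmono x : setT x -> {homo g ^~ x : n m / (n <= m)%N >-> (n <= m)%E}.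
  move=> _ n m nm; rewrite /g !patchE.
  case: ifPn => [xn|_]; last by case: ifP => //; rewrite lee_fin truncate_ge0.
  have nm' : n%:R <= m%:R :> RT by rewrite ler_nat.
  rewrite ifT; first by rewrite lee_fin /truncate le_min !ge_min lexx/= nm' orbT.
  move: xn; rewrite !inE /=; apply: subset_itv; by rewrite bnd_simp ?lerN2.
have limg x : limn (g ^~ x) = (Num.max (F x) 0)%:E.
  apply: lim_near_cst => //.
  exists (Num.truncn (Num.max `|x| `|F x|)).+1 => // n /= xn.
  have : Num.max `|x| `|F x| <= n%:R.
    by apply: (le_trans (ltW (truncnS_gt _))); rewrite ler_nat.
  rewrite ge_max => /andP[xn' Fn].
  rewrite /g patchT; last by rewrite inE /= in_itv /= -ler_norml.
  by rewrite /truncate min_l// ge_max ler0n andbT (le_trans (ler_norm _)).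
have := cvg_monotone_convergence (mu := mu) measurableT mg g0 gmono.
under eq_integral do rewrite limg.
move=> cg; rewrite -(cvg_lim _ cg)//; apply: lime_le; first exact: cvgP cg.
apply: nearW => n; rewrite /g -integral_mkcond leNgt.
by apply/negP; exact: small.
Qed.

(** The truncated integrals increase with both parameters and never exceed the
    full integral, so the diagonal values at integers control the whole double
    limit. *)
Lemma truncate_double_lim (F : RT -> RT) : measurable_fun setT F ->
  is_double_lim
    (fun rho N => \int[mu]_(x in `[- (rho : RT), (rho : RT)]) truncate F N x)
    (Rbar_of_ereal (\int[mu]_x (Num.max (F x) 0)%:E)).
Proof.
move=> mF P LP.
have L0 : (0 <= \int[mu]_x (Num.max (F x) 0)%:E)%E.
  by apply: integral_ge0 => x _; rewrite lee_fin le_max lexx orbT.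
(* A neighbourhood of the limit contains every value between some r below the
   limit and the limit itself, whether the limit is finite or not. *)
suff [r rL rP] : exists2 r : RT, (r%:E < \int[mu]_x (Num.max (F x) 0)%:E)%E &
    forall y : RT, r < y -> (y%:E <= \int[mu]_x (Num.max (F x) 0)%:E)%E -> P y.
  have [n rn] := integral_truncate_approx mF rL.
  have npinf : Rbar_locally p_infty (fun x => n%:R < (x : RT)).
    by exists n%:R => x /RltP.
  econstructor; [exact: npinf | exact: npinf |] => rho N nrho nN.
  have N0 : 0 <= N by exact: le_trans (ltW nN).
  apply: rP => /=; rewrite -?lte_fin EFin_integral_truncate//.
    apply: (lt_le_trans rn); apply: integral_truncate_mono => //; exact: ltW.
  exact: integral_truncate_le.
case: (\int[mu]_x _)%E L0 LP => [l| |] //= _.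
  move=> [e eP]; exists (l - pos e).
    by rewrite lte_fin ltrBlDr ltrDl; apply/RltP/cond_pos.
  move=> y ly; rewrite lee_fin => yl; apply: eP.
  change (Rlt (Rabs (Rminus y l)) e); apply/RltP; rewrite RabsE RminusE.
  by rewrite distrC ger0_norm ?subr_ge0// ltrBlDr -ltrBlDl.
by move=> [M MP]; exists M; [rewrite ltry | move=> y /RltP/MP].
Qed.

(** * Summability is Lebesgue integrability of a Borel version *)

Lemma is_double_lim_ext (G H : R -> R -> R) (l : Rbar) :
  (forall rho N : R, (0 < rho)%coqR -> (0 < N)%coqR -> G rho N = H rho N) ->
  is_double_lim G l -> is_double_lim H l.
Proof.
move=> GH; apply: filterlim_ext_loc.
have pos : Rbar_locally p_infty (fun x => (0 < x)%coqR) by exists 0%coqR.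
by econstructor; [exact: pos | exact: pos | exact: GH].
Qed.

Lemma is_double_lim_unique (G : R -> R -> R) (l l' : Rbar) :
  is_double_lim G l -> is_double_lim G l' -> l = l'.
Proof.
have diag (m : Rbar) : is_double_lim G m -> Lim_seq (fun n => G (INR n) (INR n)) = m.
  move=> Gm; apply: is_lim_seq_unique.
  apply: (filterlim_comp _ _ _ (fun n => (INR n, INR n)) _ _ _ _ _ Gm).
  by apply: filterlim_pair; exact: is_lim_seq_INR.
by move=> /diag <- /diag.
Qed.

Lemma borel_version_comp I (f f' : pfun) (F : RT -> RT) (u : RT -> RT) :
  pdom f' = pdom f -> (forall x, f' x = u (f x)) ->
  measurable_fun setT (u \o F) -> borel_version I f F ->
  borel_version I f' (u \o F).
Proof.
move=> domE valE mu_F [_ F0]; split => //; apply: mu0_sub F0 => x /= [Ix nf'].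
by split => // -[fx fF]; apply: nf'; rewrite domE valE fF.
Qed.

Lemma TInt_cut_above (f : pfun) (F : RT -> RT) (rho N : R) :
  borel_version setT f F -> (0 < rho)%coqR -> (0 < N)%coqR ->
  TInt (cut_above N (pos_part f)) (- rho)%coqR rho =
  \int[mu]_(x in `[- (rho : RT), (rho : RT)]) truncate F N x.
Proof.
move=> fF rho0 /RltP/ltW N0.
have fT := borel_version_sub (subsetT (segment (- rho)%coqR rho)) fF.
have trN x : (Rabs (cut_above N (pos_part f) x) <= N)%coqR.
  by apply/RleP; rewrite RabsE /= RminE RmaxE; exact: (@truncate_norm (pval f)).
apply: (@TInt_integral _ _ _ _ N).
- by Lra.lra.
- apply: (borel_version_comp (u := truncate id N)) fT => //.
    by move=> x /=; rewrite RminE RmaxE.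
  by case: fF => mF _; exact: measurable_truncate.
- by move=> x _ _; exact: trN.
- by move=> x; exact: truncate_norm.
Qed.

(** The negative part has the sign convention [min (f, 0)]; cutting it below at
    [- N] is minus the truncation of [- f] at height [N], which reduces this
    case to positive parts. *)
Lemma TInt_cut_below (f : pfun) (F : RT -> RT) (rho N : R) :
  borel_version setT f F -> (0 < rho)%coqR -> (0 < N)%coqR ->
  TInt (cut_below N (neg_part f)) (- rho)%coqR rho =
  (- \int[mu]_(x in `[- (rho : RT), (rho : RT)]) truncate (\- F) N x)%coqR.
Proof.
move=> fF rho0 /RltP/ltW N0.
have fT := borel_version_sub (subsetT (segment (- rho)%coqR rho)) fF.
have mNF : measurable_fun setT (\- F) by case: fF => mF _; exact: measurableT_comp.
have valE x : cut_below N (neg_part f) x = - truncate (\- pval f) N x.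
  by rewrite /= RmaxE RminE RoppE /truncate oppr_min oppr_max opprK oppr0.
have trN x : (Rabs (cut_below N (neg_part f) x) <= N)%coqR.
  by apply/RleP; rewrite valE RabsE normrN; exact: truncate_norm.
transitivity (\int[mu]_(x in `[- (rho : RT), (rho : RT)]) (- truncate (\- F) N x)).
  apply: (@TInt_integral _ _ _ _ N).
  - by Lra.lra.
  - apply: (borel_version_comp (u := fun y => - truncate (@GRing.opp RT) N y)) fT => //.
    rewrite (_ : _ \o F = fun x => - truncate (\- F) N x)//.
    by apply: measurableT_comp => //; exact: measurable_truncate.
  - by move=> x _ _; exact: trN.
  - by move=> x; rewrite normrN; exact: truncate_norm.
rewrite /Rintegral RoppE -fineN; congr fine.
under eq_integral do rewrite EFinN.
by rewrite integral_ge0N// => x _; rewrite lee_fin truncate_ge0.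
Qed.

Lemma is_LInt_pos_integral (f : pfun) (F : RT -> RT) (l : Rbar) :
  borel_version setT f F ->
  is_LInt_pos f l <-> l = Rbar_of_ereal (\int[mu]_x (Num.max (F x) 0)%:E).
Proof.
move=> fF; have [mF _] := fF.
have fl : is_LInt_pos f (Rbar_of_ereal (\int[mu]_x (Num.max (F x) 0)%:E)).
  apply: is_double_lim_ext (truncate_double_lim mF) => rho N rho0 N0.
  by rewrite (TInt_cut_above fF).
by split=> [/is_double_lim_unique/(_ fl)//|->].
Qed.

Lemma is_LInt_neg_integral (f : pfun) (F : RT -> RT) (l : Rbar) :
  borel_version setT f F ->
  is_LInt_neg f l <->
  l = Rbar_opp (Rbar_of_ereal (\int[mu]_x (Num.max (- F x) 0)%:E)).
Proof.
move=> fF; have [mF _] := fF.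
have mNF : measurable_fun setT (\- F) by exact: measurableT_comp.
have fl : is_LInt_neg f
    (Rbar_opp (Rbar_of_ereal (\int[mu]_x (Num.max (- F x) 0)%:E))).
  have limN : is_double_lim (fun rho N =>
      (- \int[mu]_(x in `[- (rho : RT), (rho : RT)]) truncate (\- F) N x)%coqR)
      (Rbar_opp (Rbar_of_ereal (\int[mu]_x (Num.max (- F x) 0)%:E))).
    exact: filterlim_comp (truncate_double_lim mNF) (filterlim_Rbar_opp _).
  apply: is_double_lim_ext limN => rho N rho0 N0.
  by rewrite (TInt_cut_below fF).
by split=> [/is_double_lim_unique/(_ fl)//|->].
Qed.

(** A finite sum forces both terms to be finite, once one of them is: an
    infinite partner would make the sum infinite. *)
Lemma Rbar_of_ereal_sub (a b : \bar RT) (l : R) : (0 <= a)%E -> (0 <= b)%E ->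
  (is_finite (Rbar_of_ereal a) \/ is_finite (Rbar_opp (Rbar_of_ereal b))) /\
    Rbar.Finite l = Rbar_plus (Rbar_of_ereal a) (Rbar_opp (Rbar_of_ereal b)) <->
  [/\ (a < +oo)%E, (b < +oo)%E & l = fine (a - b)].
Proof.
case: a => [a| |] // _; case: b => [b| |] // _; split=> [[fin //]|[]//].
- by move=> [->]; rewrite !ltry.
- by move=> _ _ ->; split => //; left.
- by case: fin.
Qed.

(** The positive and negative integrals of [f] are those of [F], and [F] is
    integrable exactly when both are finite. *)
Lemma is_LInt_integral (f : pfun) (F : RT -> RT) (l : R) :
  borel_version setT f F ->
  is_LInt f (Rbar.Finite l) <->
  mu.-integrable setT (EFin \o F) /\ l = \int[mu]_x F x.
Proof.
move=> fF; have [mF _] := fF.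
have max_ge0 (G : RT -> RT) x : (0 <= (Num.max (G x) 0)%:E)%E.
  by rewrite lee_fin le_max lexx orbT.
have posE : ((EFin \o F)^\+ = fun x => (Num.max (F x) 0)%:E)%E.
  by apply/funext => x; rewrite funeposE -EFin_max.
have negE : ((EFin \o F)^\- = fun x => (Num.max (- F x) 0)%:E)%E.
  by apply/funext => x; rewrite funenegE -EFinN -EFin_max.
have intE : \int[mu]_x F x = fine (\int[mu]_x (Num.max (F x) 0)%:E -
                                  \int[mu]_x (Num.max (- F x) 0)%:E)%E.
  rewrite /Rintegral integralE.
  by rewrite -[X in integral _ _ X^\+%E]/(EFin \o F) posE negE.
have subP := @Rbar_of_ereal_sub _ _ l
  (@integral_ge0 _ _ _ mu setT _ (fun x _ => max_ge0 F x))
  (@integral_ge0 _ _ _ mu setT _ (fun x _ => max_ge0 (\- F) x)).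
split.
  move=> [_ [lp [lm [/(is_LInt_pos_integral _ fF) -> [/(is_LInt_neg_integral _ fF) -> ]]]]].
  move=> /subP[pfin nfin lE]; split; last by rewrite lE intE.
  apply/integrableP; split; first exact/measurable_EFinP.
  rewrite (_ : (fun x => _) = ((EFin \o F)^\+ \+ (EFin \o F)^\-)%E); last first.
    by rewrite -fune_abse.
  rewrite posE negE ge0_integralD//.
  - by rewrite lte_add_pinfty.
  - by apply/measurable_EFinP; exact: measurable_maxr.
  - by apply/measurable_EFinP; apply: measurable_maxr => //; exact: measurableT_comp.
move=> [iF lE]; split; first exact: borel_version_quasicontinuous fF.
do 2 eexists; split; first by apply/(is_LInt_pos_integral _ fF).
split; first by apply/(is_LInt_neg_integral _ fF).
apply/subP; split; last by rewrite lE intE.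
  by have := integral_funepos_lt_pinfty measurableT iF; rewrite posE.
by have := integral_funeneg_lt_pinfty measurableT iF; rewrite negE.
Qed.

Lemma LInt_integral (f : pfun) (F : RT -> RT) :
  borel_version setT f F -> mu.-integrable setT (EFin \o F) ->
  LInt f = \int[mu]_x F x.
Proof.
move=> fF iF; apply: iota_unique.
  by move=> y /(is_LInt_integral _ fF)[].
exact/(is_LInt_integral _ fF).
Qed.

(** * Dominated convergence *)

Lemma is_lim_seq_cvg (u : nat -> R) (l : R) :
  is_lim_seq u (Rbar.Finite l) <-> (u : nat -> RT) @ \oo --> (l : RT).
Proof.
rewrite is_lim_seq_Reals; split => [ul|ul e /RltP e0].
  apply/cvgrPdist_lt => e e0; have /RltP e0' := e0.
  have [N Nul] := ul e e0'; exists N => // n /= /ssrnat.leP/Nul/RltP.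
  by rewrite RdistE distrC.
move/cvgrPdist_lt: ul => /(_ e e0)[N _ Nul].
exists N => n /ssrnat.leP/Nul /= uln; apply/RltP.
by rewrite RdistE distrC.
Qed.

Lemma borel_version_restrict (f : pfun) (F : RT -> RT) (N : set RT) :
  measurable N -> mu N = 0%E -> measurable_fun setT F ->
  (forall x, ~ N x -> pdom f x /\ f x = F x) ->
  borel_version setT f (F \_ (~` N)).
Proof.
move=> mN N0 mF fF; split.
  apply: (measurable_restrictT _ _).1; first exact: measurableC.
  exact: measurable_funTS.
apply: mu0_sub N0 => x /= [_ nfF]; apply: contrapT => nNx; apply: nfF.
by rewrite patchT ?inE//; exact: fF.
Qed.

(** Countably many almost everywhere statements are involved; their exceptional
    sets are gathered in [bad] and enlarged to one Borel null set [N].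
    Restricting all Borel versions to the complement of [N] makes convergence
    and domination hold at every point, so that the limit is Borel. *)
Lemma dominated_convergence_tonelli (fn : nat -> pfun) (f g : pfun) :
  (forall n, summable (fn n)) -> cvg_ae fn f -> summable g ->
  (forall n, dominated_ae (fn n) g) ->
  summable f /\ is_lim_seq (fun n => LInt (fn n)) (Rbar.Finite (LInt f)).
Proof.
move=> fn_sum /null_setE fn_cvg g_sum fn_dom.
have qc h : summable h -> exists H, borel_version setT h H.
  by move=> [l [qh _]]; exact: quasicontinuous_borel_version.
have /choice[Fn FnV] := fun n => qc _ (fn_sum n).
have [G GV] := qc _ g_sum.
pose bad : set RT := [set x | line x /\ ~ ((forall n, pdom (fn n) x) /\ pdom f x /\
    is_lim_seq (fun n => fn n x) (Rbar.Finite (f x)))] `|`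
  [set x | setT x /\ ~ (pdom g x /\ g x = G x)] `|`
  \bigcup_n ([set x | setT x /\ ~ (pdom (fn n) x /\ fn n x = Fn n x)] `|`
    [set x | line x /\ ~ (pdom (fn n) x /\ pdom g x /\ (Rabs (fn n x) <= g x)%coqR)]).
have bad0 : mu bad = 0%E.
  apply: mu0_setU; first by apply: mu0_setU => //; case: GV.
  apply: mu0_bigcup => n; apply: mu0_setU; first by case: (FnV n).
  exact/null_setE/fn_dom.
have [N [mN N0 badN]] := (negligible_outer_measure bad).2 bad0.
have good x : ~ N x -> [/\ pdom f x,
    is_lim_seq (fun n => fn n x) (Rbar.Finite (f x)), pdom g x /\ g x = G x &
    forall n, (pdom (fn n) x /\ fn n x = Fn n x) /\ (Rabs (fn n x) <= g x)%coqR].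
  move=> nNx; have nbad : ~ bad x by move/badN.
  have [_ [fx fnx]] : (forall n, pdom (fn n) x) /\ pdom f x /\
      is_lim_seq (fun n => fn n x) (Rbar.Finite (f x)).
    by apply: contrapT => ?; apply: nbad; left; left.
  split => //; first by apply: contrapT => ?; apply: nbad; left; right.
  move=> n; split.
    by apply: contrapT => ?; apply: nbad; right; exists n => //; left.
  have [_ []//] : pdom (fn n) x /\ pdom g x /\ (Rabs (fn n x) <= g x)%coqR.
  by apply: contrapT => ?; apply: nbad; right; exists n => //; right.
pose F : RT -> RT := pval f \_ (~` N).
pose Fn' n : RT -> RT := Fn n \_ (~` N); pose G' : RT -> RT := G \_ (~` N).
have Fn'V n : borel_version setT (fn n) (Fn' n).
  apply: borel_version_restrict => //; first by case: (FnV n).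
  by move=> x /good[_ _ _ /(_ n)[]].
have G'V : borel_version setT g G'.
  by apply: borel_version_restrict => //; [case: GV | move=> x /good[]].
have Fn'F x : (EFin \o Fn' n) x @[n --> \oo] --> (EFin \o F) x.
  apply: cvg_EFin; first exact: nearW.
  rewrite /F /Fn' /= patchE; under eq_cvg do rewrite /= patchE.
  case: ifPn => [|_]; last exact: cvg_cst.
  rewrite inE => /good[_ /is_lim_seq_cvg fnx _ fnFn].
  suff -> : (fun n => Fn n x) = (fun n => fn n x) by [].
  by apply/funext => n; rewrite (fnFn n).1.2.
have mFn' n : measurable_fun setT (EFin \o Fn' n).
  by apply/measurable_EFinP; case: (Fn'V n).
have mF : measurable_fun setT (EFin \o F).
  exact: (emeasurable_fun_cvg _ _ mFn' (fun x _ => Fn'F x)).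
have iG : mu.-integrable setT (EFin \o G').
  by have [l /(is_LInt_integral _ G'V)[]] := g_sum.
have FnG n x : (`|(EFin \o Fn' n) x| <= (EFin \o G') x)%E.
  rewrite /= lee_fin /Fn' /G' !patchE; case: ifPn => [|_]; last by rewrite normr0.
  rewrite inE => /good[_ _ [_ <-] /(_ n)[[_ <-] /RleP]].
  by rewrite RabsE.
have [iF _ limF] := dominated_convergence (mu := mu) measurableT mFn' mF
  (aeW mu (fun x _ => Fn'F x)) iG (aeW mu (fun x n _ => FnG n x)).
have FV : borel_version setT f F.
  split; first exact/measurable_EFinP.
  apply: mu0_sub N0 => x /= [_ nfF]; apply: contrapT => nNx; apply: nfF.
  by rewrite /F patchT ?inE//; have [] := good x nNx.
split; first by eexists; apply/(is_LInt_integral _ FV); split; first exact: iF.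
rewrite (LInt_integral FV iF).
apply/is_lim_seq_cvg.
have LFn n : LInt (fn n) = \int[mu]_x Fn' n x.
  apply: (LInt_integral (Fn'V n)).
  by have [l /(is_LInt_integral _ (Fn'V n))[]] := fn_sum n.
under eq_cvg do rewrite LFn.
apply: fine_cvg; rewrite /Rintegral fineK//.
exact: integrable_fin_num.
Qed.

End Lebesgue.

Import Coquelicot.
Open Scope R_scope.

Theorem theorem63 (fn : nat -> pfun) (f : pfun)
  (fn_summable : forall n, summable (fn n))
  (fn_cvg : cvg_ae fn f)
  (fn_dominated : exists g : pfun,
     summable g /\ nonnegative g /\ forall n, dominated_ae (fn n) g) :
  summable f /\ is_lim_seq (fun n => LInt (fn n)) (LInt f).
Proof.
  destruct fn_dominated as [g [g_summable [_ fn_le_g]]].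
  exact (dominated_convergence_tonelli fn_summable fn_cvg g_summable fn_le_g).
Qed.
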